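(* Let $\mathfrak{r}_1$ be a real Lie algebra of dimension four and $\mathfrak{r}_2$ a real Lie algebra of dimension two. Then the six-dimensional Lie algebra $\mathfrak{r}_1\oplus\mathfrak{r}_2$ admits a symplectic form if and only if $\mathfrak{r}_1$ admits a symplectic form.
   Context: All Lie algebras are finite-dimensional over $\mathbb{R}$. For a Lie algebra $\mathfrak{g}$, the exterior differential on $\mathfrak{g}^*$ is $d\omega(X,Y)=-\omega([X,Y])$ for $\omega\in\mathfrak{g}^*$, extended to $\bigwedge\mathfrak{g}^*$ as an antiderivation. A symplectic form on $\mathfrak{g}$ with $\dim\mathfrak{g}=2n$ is $\omega\in\bigwedge^2\mathfrak{g}^*$ with $d\omega=0$ and $\bigwedge^n\omega\neq0$. Direct sums are direct sums of Lie algebras (both summands are ideals). *)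

(* Defs.v *)
From HB Require Import structures.
From mathcomp Require Import all_boot all_order all_fingroup all_algebra.
From mathcomp Require Import ring.

Set Implicit Arguments.
Unset Strict Implicit.
Unset Printing Implicit Defensive.

Import GRing.Theory.
Local Open Scope ring_scope.

HB.mixin Record Lmodule_isLie (R : nzRingType) V of GRing.Lmodule R V := {
  lie_bracket : V -> V -> V;
  lie_linearl : forall (a : R) (x y z : V),
    lie_bracket (a *: x + y) z = a *: lie_bracket x z + lie_bracket y z;
  lie_linearr : forall (a : R) (x y z : V),
    lie_bracket x (a *: y + z) = a *: lie_bracket x y + lie_bracket x z;
  lie_alternating : forall x : V, lie_bracket x x = 0;
  lie_jacobi : forall x y z : V,
    lie_bracket x (lie_bracket y z) + lie_bracket y (lie_bracket z x)
      + lie_bracket z (lie_bracket x y) = 0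
}.

(* Finite-dimensional Lie algebras: a vectType has finite dimension. *)
#[short(type="lieAlgType")]
HB.structure Definition LieAlgebra (R : nzRingType) :=
  {V of Lmodule_isLie R V & Vector R V}.

(* The direct sum of Lie algebras is carried by the product type. *)
Section DirectSum.
Variables (R : nzRingType) (g h : lieAlgType R).

Definition dsum_bracket (x y : g * h) : g * h :=
  (lie_bracket x.1 y.1, lie_bracket x.2 y.2).

Fact dsum_linearl a x y z :
  dsum_bracket (a *: x + y) z = a *: dsum_bracket x z + dsum_bracket y z.
Proof. by rewrite /dsum_bracket /= !lie_linearl. Qed.

Fact dsum_linearr a x y z :
  dsum_bracket x (a *: y + z) = a *: dsum_bracket x y + dsum_bracket x z.
Proof. by rewrite /dsum_bracket /= !lie_linearr. Qed.

Fact dsum_alternating x : dsum_bracket x x = 0.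
Proof. by rewrite /dsum_bracket !lie_alternating. Qed.

Fact dsum_jacobi x y z :
  dsum_bracket x (dsum_bracket y z) + dsum_bracket y (dsum_bracket z x)
    + dsum_bracket z (dsum_bracket x y) = 0.
Proof. by congr (_, _); rewrite /= lie_jacobi. Qed.

HB.instance Definition _ := Lmodule_isLie.Build R (g * h)%type
  dsum_linearl dsum_linearr dsum_alternating dsum_jacobi.

End DirectSum.

Section Forms.
Variables (F : fieldType) (V : vectType F).

(* Elements of the k-th exterior power of the dual of V are the k-ary functions
   on V that satisfy [is_altform]. *)
Definition kform (k : nat) := {ffun 'I_k -> V} -> F.

Definition set_arg k (X : {ffun 'I_k -> V}) (i : 'I_k) (v : V) :
  {ffun 'I_k -> V} := [ffun j => if j == i then v else X j].

Definition is_altform k (w : kform k) : Prop :=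
  (forall (X : {ffun 'I_k -> V}) (i : 'I_k) (a : F) (u v : V),
     w (set_arg X i (a *: u + v)) = a * w (set_arg X i u) + w (set_arg X i v))
  /\ (forall (X : {ffun 'I_k -> V}) (i j : 'I_k),
     i != j -> X i = X j -> w X = 0).

(* In this normalisation, (a /\ b)(x, y) = a(x) b(y) - a(y) b(x) for 1-forms.
   The factor 1 / (p! q!) is meaningful in characteristic 0 only. *)
Definition wedge p q (a : kform p) (b : kform q) : kform (p + q)%N := fun X =>
  (p`! * q`!)%N%:R^-1 * \sum_(s : 'S_(p + q))
    (-1) ^+ s * a [ffun i => X (s (lshift q i))]
              * b [ffun j => X (s (rshift p j))].

Fixpoint wedge_pow (w : kform 2) (n : nat) {struct n} : kform n.*2 :=
  match n with 0 => fun=> 1 | m.+1 => wedge w (@wedge_pow w m) end.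

End Forms.

Arguments wedge_pow {F V} w n _.

Section Differential.
Variables (F : fieldType) (g : lieAlgType F).

(* The arguments ([X_i, X_j], X_0, ..., X_k+1) with X_i and X_j omitted from the
   tail, where j = lift i j'. *)
Definition contract_args k (X : {ffun 'I_k.+2 -> g})
    (i : 'I_k.+2) (j' : 'I_k.+1) : {ffun 'I_k.+1 -> g} :=
  [ffun s => if unlift ord0 s is Some t then X (lift i (lift j' t))
             else lie_bracket (X i) (X (lift i j'))].

(* The antiderivation of the exterior algebra of the dual of g extending
   (d w)(x, y) = - w [x, y], in positive degree:
     (d w)(X_0, ..., X_k+1) =
       \sum_(i < j) (-1)^(i + j) w([X_i, X_j], .. ^X_i .. ^X_j ..).
   See [ext_diff1], [ext_diff_wedge] and [ext_diff_linear], which determine d on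
   1-forms and on 2-forms. *)
Definition ext_diff k (w : kform g k.+1) : kform g k.+2 := fun X =>
  \sum_(i < k.+2) \sum_(j' < k.+1 | (i < lift i j')%N)
    (-1) ^+ (i + lift i j')%N * w (contract_args X i j').

Definition is_symplectic (w : kform g 2) : Prop :=
  [/\ is_altform w,
      (forall X, ext_diff w X = 0) &
      exists n : nat, \dim {:g} = n.*2 /\ exists X, wedge_pow w n X <> 0].

Definition admits_symplectic : Prop := exists w : kform g 2, is_symplectic w.

End Differential.

Arguments admits_symplectic {F} g.

Section Antiderivation.
Variables (F : fieldType) (g : lieAlgType F).

Lemma sum_perm_lift n (f : 'S_n.+1 -> F) :
  \sum_s f s = \sum_(i < n.+1) \sum_(s : 'S_n) f (lift_perm ord0 i s).
Proof.
rewrite (partition_big (fun s : 'S_n.+1 => s ord0) predT) //=.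
apply: eq_bigr => i _.
pose dn (s : 'S_n.+1) (k : 'I_n) := odflt k (unlift (s ord0) (s (lift ord0 k))).
have dn_inj s : injective (dn s).
  move=> k1 k2; rewrite /dn.
  have l k : lift ord0 k != ord0 by rewrite eq_sym neq_lift.
  have e k : s ord0 != s (lift ord0 k) by rewrite (inj_eq perm_inj) neq_lift.
  case: (unlift_some (e k1)) => j1 E1 ->; case: (unlift_some (e k2)) => j2 E2 -> /= E.
  by apply: (@lift_inj _ ord0); apply: (@perm_inj _ s); rewrite E1 E2 E.
rewrite (reindex (lift_perm ord0 i)); last first.
  exists (fun s => perm (dn_inj s)) => s.
    move=> _; apply/permP => k; rewrite permE /dn lift_perm_id lift_perm_lift liftK //.
  rewrite inE => /eqP si; apply/permP => k.
  case: (unliftP ord0 k) => [j|] ->; last by rewrite lift_perm_id si.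
  rewrite lift_perm_lift permE /dn.
  have e : s ord0 != s (lift ord0 j) by rewrite (inj_eq perm_inj) neq_lift.
  by case: (unlift_some e) => j' E -> /=; rewrite E si.
by apply: eq_bigl => s; rewrite lift_perm_id eqxx.
Qed.

Lemma ffun1E (X Y : {ffun 'I_1 -> g}) : X ord0 = Y ord0 -> X = Y.
Proof. by move=> e; apply/ffunP => i; rewrite !ord1. Qed.

Lemma ext_diff1 (w : kform g 1) (X : {ffun 'I_2 -> g}) :
  ext_diff w X = - w [ffun=> lie_bracket (X ord0) (X ord_max)].
Proof.
rewrite /ext_diff !big_ord_recl big_ord0 !big_mkcond /= !big_ord_recl !big_ord0 /=.
rewrite expr1 !addr0 mulN1r; congr (- w _).
apply: ffun1E; rewrite !ffunE unlift_none; congr (lie_bracket _ (X _)).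
exact: val_inj.
Qed.

Let i1 {n} : 'I_n.+2 := lift ord0 ord0.
Let i2 {n} : 'I_n.+3 := lift ord0 i1.

Lemma sum_perm0 (f : 'S_0 -> F) : \sum_s f s = f 1%g.
Proof.
by rewrite (bigD1 1%g) //= big1 ?addr0 // => s /eqP[]; apply/permP => -[].
Qed.

Lemma sum_perm2 (f : 'I_2 -> 'I_2 -> F) :
  \sum_(s : 'S_2) (-1) ^+ s * f (s ord0) (s i1) = f ord0 i1 - f i1 ord0.
Proof.
rewrite sum_perm_lift !big_ord_recl big_ord0 !sum_perm_lift.
rewrite !big_ord_recl !big_ord0 !sum_perm0 !odd_lift_perm !odd_perm1 /=.
rewrite /i1 !lift_perm_lift !lift_perm_id.
have -> : lift (lift ord0 ord0) ord0 = ord0 :> 'I_2 by exact: val_inj.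
ring.
Qed.

Lemma sum_perm3 (f : 'I_3 -> 'I_3 -> 'I_3 -> F) :
  \sum_(s : 'S_3) (-1) ^+ s * f (s ord0) (s i1) (s i2)
  = f ord0 i1 i2 - f ord0 i2 i1 - f i1 ord0 i2
    + f i1 i2 ord0 + f i2 ord0 i1 - f i2 i1 ord0.
Proof.
rewrite sum_perm_lift.
under eq_bigr => i _.
  rewrite (eq_bigr (fun s : 'S_2 => (-1) ^+ s * ((-1) ^+ i *
     f i (lift i (s ord0)) (lift i (s i1))))); last first.
    move=> s _; rewrite odd_lift_perm /i2 /i1 !lift_perm_lift lift_perm_id /=.
    by rewrite signr_addb signr_odd mulrA [X in _ = X * _]mulrC.
  rewrite (sum_perm2 (fun j k => (-1) ^+ i * f i (lift i j) (lift i k))).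
  over.
rewrite !big_ord_recl big_ord0.
have e10 : lift i1 ord0 = ord0 :> 'I_3 by exact: val_inj.
have e11 : lift i1 i1 = i2 :> 'I_3 by exact: val_inj.
have e20 : lift i2 ord0 = ord0 :> 'I_3 by exact: val_inj.
have e21 : lift i2 i1 = i1 :> 'I_3 by exact: val_inj.
rewrite -/i1 -/i2 e10 e11 e20 e21 /=.
move: (f _ _ _) (f _ _ _) (f _ _ _) (f _ _ _) (f _ _ _) (f _ _ _).
by move=> *; ring.
Qed.

Let kform1E (a : kform g 1) X : a X = a [ffun=> X ord0].
Proof. by congr a; apply: ffun1E; rewrite ffunE. Qed.

Let wedge11 (a b : kform g 1) (X : {ffun 'I_2 -> g}) :
  wedge a b X = a [ffun=> X ord0] * b [ffun=> X i1]
              - a [ffun=> X i1] * b [ffun=> X ord0].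
Proof.
have e0 : lshift 1 (@ord0 0) = ord0 :> 'I_2 by exact: val_inj.
have e1 : rshift 1 (@ord0 0) = i1 :> 'I_2 by exact: val_inj.
rewrite /wedge invr1 mul1r.
rewrite -(sum_perm2 (fun j k => a [ffun=> X j] * b [ffun=> X k])).
apply: eq_bigr => s _.
by rewrite kform1E [X in _ * X = _]kform1E !ffunE e0 e1 mulrA.
Qed.

Let d1E (a : kform g 1) (X : {ffun 'I_2 -> g}) :
  ext_diff a X = - a [ffun=> lie_bracket (X ord0) (X i1)].
Proof.
by rewrite ext_diff1; have -> : i1 = ord_max :> 'I_2 by exact: val_inj.
Qed.

Lemma lie_anti (x y : g) : lie_bracket y x = - lie_bracket x y.
Proof.
apply/eqP; rewrite -addr_eq0.
have := lie_alternating (x + y).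
have D a b c : lie_bracket (a + b) c = lie_bracket a c + lie_bracket b c :> g.
  by rewrite -[a]scale1r lie_linearl !scale1r.
have D' a b c : lie_bracket c (a + b) = lie_bracket c a + lie_bracket c b :> g.
  by rewrite -[a]scale1r lie_linearr !scale1r.
by rewrite D !D' !lie_alternating add0r addr0 addrC => ->.
Qed.

Lemma altform1N (a : kform g 1) (v : g) : is_altform a ->
  a [ffun=> - v] = - a [ffun=> v].
Proof.
case=> lin _.
have E u : set_arg [ffun=> 0] ord0 u = [ffun=> u] :> {ffun 'I_1 -> g}.
  by apply: ffun1E; rewrite !ffunE.
have a0 : a [ffun=> 0] = 0.
  have := lin [ffun=> 0] ord0 (-1) 0 0.
  by rewrite !E scaler0 addr0 mulN1r addNr.
by have := lin [ffun=> 0] ord0 (-1) v 0; rewrite !E scaleN1r addr0 a0 addr0 mulN1r.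
Qed.

Let wedge21 (a b : kform g 1) (X : {ffun 'I_3 -> g}) :
  (2%:R : F) != 0 -> is_altform a ->
  let c i j := a [ffun=> lie_bracket (X i) (X j)] in
  let v i := b [ffun=> X i] in
  wedge (ext_diff a) b X =
  - c ord0 i1 * v i2 + c ord0 i2 * v i1 - c i1 i2 * v ord0.
Proof.
move=> nz2 aa c v.
have cN i j : c j i = - c i j by rewrite /c lie_anti altform1N.
have e0 : lshift 1 (@ord0 1) = ord0 :> 'I_3 by exact: val_inj.
have e1 : lshift 1 (@i1 0) = i1 :> 'I_3 by exact: val_inj.
have e2 : rshift 2 (@ord0 0) = i2 :> 'I_3 by exact: val_inj.
rewrite /wedge.
rewrite (eq_bigr (fun s : 'S_3 => (-1) ^+ s *
    (- c (s ord0) (s i1) * v (s i2)))); last first.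
  by move=> s _; rewrite d1E [X in _ * X = _]kform1E !ffunE e0 e1 e2 mulrA.
rewrite (sum_perm3 (fun i j k => - c i j * v k)).
rewrite (cN ord0 i1) (cN ord0 i2) (cN i1 i2) muln1.
have -> : 2`!%:R = 2%:R :> F by [].
by move: (c _ _) (c _ _) (c _ _) (v _) (v _) (v _) => *; field.
Qed.

Let wedge12 (a b : kform g 1) (X : {ffun 'I_3 -> g}) :
  (2%:R : F) != 0 -> is_altform b ->
  let c i j := b [ffun=> lie_bracket (X i) (X j)] in
  let v i := a [ffun=> X i] in
  wedge a (ext_diff b) X =
  - v ord0 * c i1 i2 + v i1 * c ord0 i2 - v i2 * c ord0 i1.
Proof.
move=> nz2 bb c v.
have cN i j : c j i = - c i j by rewrite /c lie_anti altform1N.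
have e0 : lshift 2 (@ord0 0) = ord0 :> 'I_3 by exact: val_inj.
have e1 : rshift 1 (@ord0 1) = i1 :> 'I_3 by exact: val_inj.
have e2 : rshift 1 (@i1 0) = i2 :> 'I_3 by exact: val_inj.
rewrite /wedge.
rewrite (eq_bigr (fun s : 'S_3 => (-1) ^+ s *
    (v (s ord0) * - c (s i1) (s i2)))); last first.
  by move=> s _; rewrite d1E [X in _ * X * _ = _]kform1E !ffunE e0 e1 e2 mulrA.
rewrite (sum_perm3 (fun i j k => v i * - c j k)).
rewrite (cN ord0 i1) (cN ord0 i2) (cN i1 i2) mul1n.
have -> : 2`!%:R = 2%:R :> F by [].
by move: (c _ _) (c _ _) (c _ _) (v _) (v _) (v _) => *; field.
Qed.

Lemma ext_diff2 (w : kform g 2) (X : {ffun 'I_3 -> g}) :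
  let b i j k : {ffun 'I_2 -> g} :=
    [ffun s => if s == ord0 then lie_bracket (X i) (X j) else X k] in
  ext_diff w X = - w (b ord0 i1 i2) + w (b ord0 i2 i1) - w (b i1 i2 ord0).
Proof.
move=> b.
have E (i : 'I_3) (j : 'I_2) :
    contract_args X i j = b i (lift i j) (lift i (lift j ord0)).
  apply/ffunP => s; rewrite !ffunE.
  case: (unliftP ord0 s) => [t|] ->; last by rewrite eqxx.
  by rewrite eq_sym (negbTE (neq_lift _ _)) ord1.
rewrite /ext_diff !big_ord_recl big_ord0 !big_mkcond /= !big_ord_recl !big_ord0.
rewrite !E /=.
have e01 : lift ord0 (lift ord0 ord0) = i2 :> 'I_3 by [].
have el : lift (lift ord0 ord0) ord0 = ord0 :> 'I_2 by exact: val_inj.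
have e10 : lift i1 ord0 = ord0 :> 'I_3 by exact: val_inj.
have e11 : lift i1 i1 = i2 :> 'I_3 by exact: val_inj.
rewrite el -/i1 e10 e11 -/i2.
rewrite /bump /= ?(addr0, add0r).
rewrite [X in _ + (_ + X)]big_pred0 ?addr0; last by case=> [[|[|]]].
move: (w (b ord0 i1 i2)) (w (b ord0 i2 i1)) (w (b i1 i2 ord0)) => *.
ring.
Qed.

Lemma ext_diff_wedge (a b : kform g 1) X : (2%:R : F) != 0 ->
  is_altform a -> is_altform b ->
  ext_diff (wedge a b) X = wedge (ext_diff a) b X - wedge a (ext_diff b) X.
Proof.
move=> nz2 aa bb; rewrite wedge21 // wedge12 // ext_diff2 !wedge11.
have E (c : kform g 1) i j k : c [ffun=> [ffun s : 'I_2 => if s == ord0 then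
  lie_bracket (X i) (X j) else X k] ord0] = c [ffun=> lie_bracket (X i) (X j)].
  by congr c; apply: ffun1E; rewrite !ffunE.
have E' (c : kform g 1) i j k : c [ffun=> [ffun s : 'I_2 => if s == ord0 then
  lie_bracket (X i) (X j) else X k] i1] = c [ffun=> X k].
  by congr c; apply: ffun1E; rewrite !ffunE.
rewrite !E !E'.
move: (a _) (a _) (a _) (a _) (a _) (a _) (b _) (b _) (b _) (b _) (b _) (b _).
by move=> *; ring.
Qed.

End Antiderivation.

(* Main.v *)
(** The value of [w ^ n] on a basis decides nondegeneracy, and for n = 2, 3 it is
  a multiple of the Pfaffian of the Gram matrix of w.  Let w be closed on
  r1 + r2, let f0, f1 be a basis of r2, w1 the restriction of w to r1,
  alpha = w(., f0) and beta = w(., f1) on r1.  Since [x, z] = 0 for x in r1 and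
  z in r2, closedness of w gives w([x, y], z) = 0, i.e. alpha and beta are
  closed.  On a basis adapted to the sum the Pfaffian of w equals
    w(f0, f1) Pf(w1) - (Pf(w1 + alpha /\ beta) - Pf(w1)),
  so if it is nonzero, one of the closed forms w1 and w1 + alpha /\ beta is
  nondegenerate.  Conversely the area form of r2 is closed for dimension reasons,
  and adding it to a symplectic form of r1 yields one on the sum. *)

Require Import Defs.
From mathcomp Require Import all_boot all_order all_fingroup all_algebra.
From mathcomp Require Import ring.
From mathcomp Require Import reals.

Set Implicit Arguments.
Unset Strict Implicit.
Unset Printing Implicit Defensive.

Import GRing.Theory Num.Theory.
Local Open Scope ring_scope.

(** * Multilinear and antisymmetric forms, and their values on a basis *)

Definition pair_args (T : Type) (x y : T) : {ffun 'I_2 -> T} :=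
  [ffun i => if i == ord0 then x else y].

Lemma pair_argsE (T : Type) (X : {ffun 'I_2 -> T}) :
  X = pair_args (X ord0) (X (lift ord0 ord0)).
Proof.
apply/ffunP => i; rewrite ffunE; case: (unliftP ord0 i) => [j|] -> //.
by rewrite ord1.
Qed.

Section Multilinear.
Variables (F : numFieldType) (V : vectType F).

Definition multilinear k (w : kform V k) : Prop :=
  forall (X : {ffun 'I_k -> V}) (i : 'I_k) (a : F) (u v : V),
    w (set_arg X i (a *: u + v)) = a * w (set_arg X i u) + w (set_arg X i v).

(** Stated for all permutations because this is what reindexing the sum in [wedge] gives; in
    characteristic 0 it implies that the form is alternating. *)
Definition antisymmetric_form k (w : kform V k) : Prop :=
  forall (X : {ffun 'I_k -> V}) (s : 'S_k),
    w [ffun i => X (s i)] = (-1) ^+ s * w X.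

Lemma multilinear_sum k (w : kform V k) (X : {ffun 'I_k -> V}) (i : 'I_k)
    n (a : 'I_n -> F) (u : 'I_n -> V) : multilinear w ->
  w (set_arg X i (\sum_(j < n) a j *: u j)) = \sum_j a j * w (set_arg X i (u j)).
Proof.
move=> lin.
have w0 : w (set_arg X i 0) = 0.
  by have := lin X i (-1) 0 0; rewrite scaler0 addr0 mulN1r addNr => ->.
elim: n a u => [|n IHn] a u; first by rewrite !big_ord0 w0.
by rewrite !big_ord_recl lin IHn.
Qed.

Lemma antisymmetric_alternating k (w : kform V k) (X : {ffun 'I_k -> V}) i j :
  antisymmetric_form w -> i != j -> X i = X j -> w X = 0.
Proof.
move=> anti ij Xij; have := anti X (tperm i j).
have -> : [ffun l => X (tperm i j l)] = X.
  by apply/ffunP => l; rewrite ffunE; case: tpermP => // ->.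
rewrite odd_tperm ij expr1 mulN1r => /eqP.
by rewrite -addr_eq0 -mulr2n mulrn_eq0 /= => /eqP.
Qed.

(** Arguments are replaced by basis vectors one at a time: expanding one argument yields a sum with
    a nonzero term. *)
Lemma multilinear_neq0_basis k (w : kform V k) n (e : n.-tuple V) X :
  multilinear w -> basis_of fullv e -> w X != 0 ->
  exists f : {ffun 'I_k -> 'I_n}, w [ffun i => e`_(f i)] != 0.
Proof.
move=> lin be.
have expand x : x = \sum_(j < n) coord e j x *: e`_j.
  exact: coord_basis be (memvf x).
(* Induction on the number [m] of leading arguments that are still arbitrary; for [m = k] the
   condition on [X] is vacuous. *)
suff IH m : forall X : {ffun 'I_k -> V},
    (forall i : 'I_k, (m <= i)%N -> X i \in e) -> w X != 0 ->
    exists f : {ffun 'I_k -> 'I_n}, w [ffun i => e`_(f i)] != 0.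
  by apply: (IH k) => i; rewrite leqNgt ltn_ord.
elim: m {X} => [|m IHm] X Xe wX.
  have lt i : (index (X i) e < n)%N.
    by rewrite -{2}(size_tuple e) index_mem Xe.
  exists [ffun i => Ordinal (lt i)].
  suff -> : [ffun i => e`_([ffun i => Ordinal (lt i)] i)] = X by [].
  by apply/ffunP => i; rewrite !ffunE nth_index ?Xe.
have [km|mk] := leqP k m.
  by apply: (IHm X) => // i mi; have := leq_trans km mi; rewrite leqNgt ltn_ord.
pose im := Ordinal mk.
have eX : X = set_arg X im (X im).
  by apply/ffunP => i; rewrite ffunE; case: eqP => // ->.
have [j wj] : exists j : 'I_n, w (set_arg X im e`_j) != 0.
  apply/existsP; apply: contraNT wX; rewrite negb_exists => /forallP w0.
  rewrite eX (expand (X im)) multilinear_sum // big1 // => j _.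
  by have := w0 j; rewrite negbK => /eqP ->; rewrite mulr0.
apply: IHm wj => i mi; rewrite ffunE; case: eqP => [_|/eqP ne].
  by rewrite mem_nth // size_tuple.
by apply: Xe; rewrite ltn_neqAle mi andbT eq_sym.
Qed.

(** A choice of basis vectors with nonzero value has no repetition, hence is a permutation of the
    basis, and antisymmetry changes its value by a sign only. *)
Lemma top_form_basis k (w : kform V k) (e : k.-tuple V) X :
  multilinear w -> antisymmetric_form w -> basis_of fullv e ->
  w X != 0 -> w [ffun i : 'I_k => e`_i] != 0.
Proof.
move=> lin anti be /(multilinear_neq0_basis lin be)[f wf].
have f_inj : injective f.
  move=> i j fij; apply/eqP; apply: contraNT wf => ij.
  by rewrite (antisymmetric_alternating anti ij) // !ffunE fij.
have := anti [ffun i : 'I_k => e`_i] (perm f_inj).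
have -> : [ffun i => [ffun i : 'I_k => e`_i] (perm f_inj i)] = [ffun i => e`_(f i)].
  by apply/ffunP => i; rewrite !ffunE permE.
by move=> E; apply: contraNneq wf => w0; rewrite E w0 mulr0.
Qed.

Lemma wedge_antisymmetric p q (a : kform V p) (b : kform V q) :
  antisymmetric_form (wedge a b).
Proof.
move=> X t; rewrite /wedge mulrCA; congr (_ * _).
rewrite mulr_sumr (reindex_inj (mulIg (t^-1)%g)) /=.
apply: eq_bigr => s _.
rewrite odd_permM odd_permV signr_addb [_ * (-1) ^+ t]mulrC -!mulrA.
congr (_ * (_ * (_ * _))).
  by congr a; apply/ffunP => i; rewrite !ffunE permM permKV.
by congr b; apply/ffunP => i; rewrite !ffunE permM permKV.
Qed.

Lemma set_arg_reindex m k (X : {ffun 'I_k -> V}) (i : 'I_k) x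
    (h : 'I_m -> 'I_k) (l : 'I_m) : injective h -> h l = i ->
  [ffun j => set_arg X i x (h j)] = set_arg [ffun j => X (h j)] l x.
Proof.
by move=> h_inj hl; apply/ffunP => j; rewrite !ffunE -hl (inj_eq h_inj).
Qed.

Lemma set_arg_out m k (X : {ffun 'I_k -> V}) (i : 'I_k) x
    (h : 'I_m -> 'I_k) : (forall l, h l != i) ->
  [ffun j => set_arg X i x (h j)] = [ffun j => X (h j)].
Proof. by move=> hi; apply/ffunP => j; rewrite !ffunE (negbTE (hi j)). Qed.

(** In the term of a permutation [s], the argument at [i] enters exactly one of the two factors,
    depending on the block that contains the preimage of [i] under [s]. *)
Lemma wedge_multilinear p q (a : kform V p) (b : kform V q) :
  multilinear a -> multilinear b -> multilinear (wedge a b).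
Proof.
move=> la lb X i c u v; rewrite /wedge mulrCA -mulrDr; congr (_ * _).
rewrite mulr_sumr -big_split /=; apply: eq_bigr => s _.
pose A Y := a [ffun j => Y (s (lshift q j))].
pose B Y := b [ffun j => Y (s (rshift p j))].
suff : A (set_arg X i (c *: u + v)) * B (set_arg X i (c *: u + v)) =
    c * (A (set_arg X i u) * B (set_arg X i u))
    + A (set_arg X i v) * B (set_arg X i v).
  rewrite -!mulrA => E; rewrite [c * _]mulrCA -mulrDr; congr (_ * _); exact: E.
have lI : injective (fun l => s (lshift q l)) by move=> ? ? /perm_inj/lshift_inj.
have rI : injective (fun l => s (rshift p l)) by move=> ? ? /perm_inj/rshift_inj.
case: (split_ordP (s^-1%g i)) => l El.
  have hl : s (lshift q l) = i by rewrite -El permKV.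
  have hr l' : s (rshift p l') != i.
    by rewrite -hl (inj_eq perm_inj) eq_rlshift.
  have EB x : B (set_arg X i x) = B X := congr1 b (set_arg_out X x hr).
  have EA x : A (set_arg X i x) = _ := congr1 a (set_arg_reindex X x lI hl).
  by rewrite !EA !EB la mulrDl mulrA.
have hl : s (rshift p l) = i by rewrite -El permKV.
have hr l' : s (lshift q l') != i.
  by rewrite -hl (inj_eq perm_inj) eq_lrshift.
have EB x : B (set_arg X i x) = _ := congr1 b (set_arg_reindex X x rI hl).
have EA x : A (set_arg X i x) = A X := congr1 a (set_arg_out X x hr).
by rewrite !EA !EB lb mulrDr mulrCA.
Qed.

(** * Wedge powers of a 2-form and Pfaffians *)

Lemma wedge_pow_antisymmetric (w : kform V 2) n : antisymmetric_form (wedge_pow w n).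
Proof.
case: n => [|n]; last exact: (@wedge_antisymmetric 2 n.*2).
move=> X s /=; rewrite (_ : s = 1%g) ?odd_perm1 ?mulr1 //.
by apply/permP => -[].
Qed.

Lemma wedge_pow_multilinear (w : kform V 2) n :
  multilinear w -> multilinear (wedge_pow w n).
Proof.
by move=> lw; elim: n => [|n IHn]; [move=> X [] | apply: (@wedge_multilinear 2 n.*2)].
Qed.

Lemma wedge_powS (w : kform V 2) n (X : {ffun 'I_n.*2.+2 -> V}) :
  wedge_pow w n.+1 X = 2%:R^-1 * \sum_(i < n.*2.+2) \sum_(j < n.*2.+1)
    (-1) ^+ i * (-1) ^+ j * w (pair_args (X i) (X (lift i j)))
    * wedge_pow w n [ffun l => X (lift i (lift j l))].
Proof.
rewrite [LHS]/= /wedge sum_perm_lift.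
under eq_bigr => i _ do rewrite sum_perm_lift.
transitivity ((2`! * (n.*2)`!)%:R^-1 * ((n.*2)`!%:R * \sum_(i < n.*2.+2)
   \sum_(j < n.*2.+1)  (-1) ^+ i * (-1) ^+ j * w (pair_args (X i) (X (lift i j)))
    * wedge_pow w n [ffun l => X (lift i (lift j l))])).
  congr (_ * _); rewrite mulr_sumr; apply: eq_bigr => i _.
  rewrite mulr_sumr; apply: eq_bigr => j _.
  rewrite -card_Sn -sumr_const mulr_suml; apply: eq_bigr => s _.
  have := @wedge_pow_antisymmetric w n [ffun l => X (lift i (lift j l))] s.
  move: (wedge_pow w n [ffun l => X (lift i (lift j l))]) => Q.
  set P := wedge_pow w n [ffun l => X (lift_perm _ _ _ _)].
  have -> : [ffun l => [ffun l => X (lift i (lift j l))] (s l)] =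
      [ffun l => X (lift_perm ord0 i (lift_perm ord0 j s) (rshift 2 l))].
    apply/ffunP => l; rewrite !ffunE.
    have -> : rshift 2 l = lift ord0 (lift ord0 l) :> 'I_n.*2.+2 by exact: val_inj.
    by rewrite !lift_perm_lift.
  rewrite -/P => ->.
  have -> : [ffun l => X (lift_perm ord0 i (lift_perm ord0 j s) (@lshift 2 n.*2 l))]
      = pair_args (X i) (X (lift i j)).
    rewrite [LHS]pair_argsE !ffunE.
    have -> : @lshift 2 n.*2 (@ord0 1) = ord0 :> 'I_n.*2.+2 by exact: val_inj.
    have -> : @lshift 2 n.*2 (lift ord0 (@ord0 0)) = lift ord0 ord0 :> 'I_n.*2.+2.
      exact: val_inj.
    by rewrite lift_perm_lift !lift_perm_id.
  (* The sign of [s] occurs twice, in the sum and in reordering the arguments of the power, and so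
     cancels. *)
  rewrite !odd_lift_perm; move: (odd_perm s) => o.
  rewrite !signr_addb !signr_odd !expr0 !mul1r -!mulrA; congr (_ * (_ * _)).
  by rewrite mulrCA (mulrA ((-1) ^+ o)) -expr2 sqrr_sign mul1r.
rewrite mulrA natrM invfM mulfVK //.
by rewrite pnatr_eq0 -lt0n fact_gt0.
Qed.

(** With indices in [nat], [bump] computes once the sums are unfolded for a concrete [n]. *)
Lemma wedge_powS_nat (w : kform V 2) n (x : nat -> V) :
  wedge_pow w n.+1 [ffun i : 'I_n.+1.*2 => x i] =
  2%:R^-1 * \sum_(0 <= i < n.*2.+2) \sum_(0 <= j < n.*2.+1)
    (-1) ^+ i * (-1) ^+ j * w (pair_args (x i) (x (bump i j)))
    * wedge_pow w n [ffun l : 'I_n.*2 => x (bump i (bump j l))].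
Proof.
rewrite wedge_powS big_mkord; congr (_ * _); apply: eq_bigr => i _.
rewrite big_mkord; apply: eq_bigr => j _; rewrite !ffunE; congr (_ * _).
by congr (wedge_pow _ _ _); apply/ffunP => l; rewrite !ffunE.
Qed.

Definition pf4 (b : nat -> nat -> F) i j k l :=
  b i j * b k l - b i k * b j l + b i l * b j k.

(** The Pfaffian of order 6, expanded along the first row. *)
Definition pf6 (b : nat -> nat -> F) :=
  b 0 1 * pf4 b 2 3 4 5 - b 0 2 * pf4 b 1 3 4 5 + b 0 3 * pf4 b 1 2 4 5
  - b 0 4 * pf4 b 1 2 3 5 + b 0 5 * pf4 b 1 2 3 4.

(* With [alpha i = b i 4] and [beta i = b i 5], the bracketed difference is the
   value of [b /\ alpha /\ beta] on the first four vectors: the Pfaffian of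
   [alpha /\ beta] alone vanishes. *)
Lemma pf6_expand b : pf6 b = b 4 5 * pf4 b 0 1 2 3 -
  (pf4 (fun i j => b i j + (b i 4 * b j 5 - b j 4 * b i 5)) 0 1 2 3
   - pf4 b 0 1 2 3).
Proof. by rewrite /pf6 /pf4; ring. Qed.

Lemma wedge_pow1 (w : kform V 2) (x : nat -> V) :
  (forall x y, w (pair_args y x) = - w (pair_args x y)) ->
  wedge_pow w 1 [ffun i : 'I_2 => x i] = w (pair_args (x 0) (x 1)).
Proof.
move=> anti; rewrite wedge_powS_nat !big_nat_recl // !big_geq //=.
rewrite (anti (x 0) (x 1)).
by move: (w _) => b; field.
Qed.

(** The factor is [n!], here for [n = 2]: each of the [n!] orderings of a perfect matching
    contributes the same product. *)
Lemma wedge_pow2 (w : kform V 2) (x : nat -> V) :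
  (forall x y, w (pair_args y x) = - w (pair_args x y)) ->
  wedge_pow w 2 [ffun i : 'I_4 => x i] =
  2 * pf4 (fun i j => w (pair_args (x i) (x j))) 0 1 2 3.
Proof.
move=> anti; rewrite wedge_powS_nat.
have E i j : wedge_pow w 1 [ffun l : 'I_2 => x (bump i (bump j l))] = _ :=
  wedge_pow1 (fun l => x (bump i (bump j l))) anti.
rewrite !big_nat_recl // !big_geq // !E /bump /=.
rewrite /pf4.
have A i j : w (pair_args (x j) (x i)) = - w (pair_args (x i) (x j)) by exact: anti.
rewrite (A 0 1) (A 0 2) (A 0 3) (A 1 2) (A 1 3) (A 2 3).
do 6!move: (w _) => ?.
by field.
Qed.

Lemma wedge_pow3 (w : kform V 2) (x : nat -> V) :
  (forall x y, w (pair_args y x) = - w (pair_args x y)) ->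
  wedge_pow w 3 [ffun i : 'I_6 => x i] =
  6 * pf6 (fun i j => w (pair_args (x i) (x j))).
Proof.
move=> anti; rewrite wedge_powS_nat.
have E i j : wedge_pow w 2 [ffun l : 'I_4 => x (bump i (bump j l))] = _ :=
  wedge_pow2 (fun l => x (bump i (bump j l))) anti.
rewrite !big_nat_recl // !big_geq // !E /bump /=.
rewrite /pf6 /pf4.
have A i j : w (pair_args (x j) (x i)) = - w (pair_args (x i) (x j)) by exact: anti.
(* Only the 15 entries above the diagonal remain, as independent variables of a rational
   identity. *)
rewrite (A 0 1) (A 0 2) (A 0 3) (A 0 4) (A 0 5) (A 1 2) (A 1 3) (A 1 4) (A 1 5).
rewrite (A 2 3) (A 2 4) (A 2 5) (A 3 4) (A 3 5) (A 4 5).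
do 15!move: (w _) => ?.
by field.
Qed.

End Multilinear.

(** * Closed 2-forms and symplectic forms on a Lie algebra *)

Section LieForms.
Variables (F : numFieldType) (g : lieAlgType F).

(** Linearity in the second variable follows from the first two clauses; the third is [ext_diff]
    written out as in [ext_diff2]. Nondegeneracy is kept separate, as a condition on a Pfaffian. *)
Definition closed_form (B : g -> g -> F) : Prop :=
  [/\ forall a x y z, B (a *: x + y) z = a * B x z + B y z,
      forall x y, B y x = - B x y &
      forall x y z, - B (lie_bracket x y) z + B (lie_bracket x z) y
                      - B (lie_bracket y z) x = 0].

Definition form_of (B : g -> g -> F) : kform g 2 :=
  fun X => B (X ord0) (X (lift ord0 ord0)).

Lemma form_of_pair B x y : form_of B (pair_args x y) = B x y.
Proof. by rewrite /form_of !ffunE. Qed.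

Lemma closed_form_symplectic B n X :
  closed_form B -> \dim {:g} = n.*2 -> wedge_pow (form_of B) n X != 0 ->
  admits_symplectic g.
Proof.
case=> lin anti dB dimg BX; exists (form_of B); split.
- split=> [Y i a u v|Y i j].
    rewrite /form_of; case: (unliftP ord0 i) => [j|] ->; last by rewrite !ffunE /= lin.
    rewrite ord1 !ffunE /= (anti _ (Y ord0)) lin (anti (Y ord0)) (anti (Y ord0) v).
    by rewrite mulrN -!opprD !opprK.
  have alt x : B x x = 0.
    by apply/eqP; have /eqP := anti x x; rewrite -addr_eq0 -mulr2n mulrn_eq0.
  rewrite /form_of; case: (unliftP ord0 i) => [i'|] ->; case: (unliftP ord0 j) => [j'|] ->;
    by rewrite ?ord1 ?eqxx // => _ ->; rewrite alt.
- by move=> Y; rewrite ext_diff2 /form_of !ffunE /= dB.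
- by exists n; split=> //; exists X; apply/eqP.
Qed.

Lemma symplectic_closed_form (w : kform g 2) : Defs.is_symplectic w ->
  closed_form (fun x y : g => w (pair_args x y)).
Proof.
case=> -[lin alt] dw _.
(* The overwritten argument [y] is arbitrary; below it is taken to be 0. *)
have argl x y z : pair_args x z = set_arg (pair_args y z) ord0 x :> {ffun 'I_2 -> g}.
  by apply/ffunP => i; rewrite !ffunE; case: eqP.
have argr x y z : pair_args z x = set_arg (pair_args z y) (lift ord0 ord0) x
    :> {ffun 'I_2 -> g}.
  apply/ffunP => i; rewrite !ffunE; case: (unliftP ord0 i) => [j|] -> //.
  by rewrite ord1.
have linl a x y z :
    w (pair_args (a *: x + y) z) = a * w (pair_args x z) + w (pair_args y z).
  by rewrite (argl _ 0) lin -!argl.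
have linr x y z : w (pair_args z (x + y)) = w (pair_args z x) + w (pair_args z y).
  by rewrite (argr _ 0) -[x]scale1r lin mul1r scale1r -!argr.
have w0 x : w (pair_args x x) = 0.
  by apply: (alt _ ord0 (lift ord0 ord0)); rewrite // !ffunE.
split=> // [x y|x y z].
  have := w0 (x + y); rewrite linr -[x]scale1r !linl !scale1r !mul1r !w0 add0r addr0.
  by move/eqP; rewrite addr_eq0 => /eqP.
have := dw [ffun i : 'I_3 => [:: x; y; z]`_i]; rewrite ext_diff2.
by rewrite !ffunE.
Qed.

(** The exponent in [is_symplectic] is half the dimension, so the power is a top form and
    [top_form_basis] moves its nonvanishing to the given basis. *)
Lemma symplectic_basis (w : kform g 2) n (e : (n.*2).-tuple g) :
  Defs.is_symplectic w -> basis_of fullv e ->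
  wedge_pow w n [ffun i : 'I_n.*2 => e`_i] != 0.
Proof.
case=> -[lin _] _ [m [dimg [X /eqP wX]]] be.
have nm : n = m.
  by apply: double_inj; rewrite -dimg -(size_basis be).
rewrite -{m dimg}nm in X wX *.
apply: top_form_basis wX => //; first exact: wedge_pow_multilinear.
exact: wedge_pow_antisymmetric.
Qed.

Lemma admits_symplectic4 (e : 4.-tuple g) : basis_of fullv e ->
  admits_symplectic g <->
  exists B, closed_form B /\ pf4 (fun i j => B e`_i e`_j) 0 1 2 3 != 0.
Proof.
move=> be; split=> [[w sw]|[B [cB pfB]]].
  have cw := symplectic_closed_form sw.
  exists (fun x y : g => w (pair_args x y)); split=> //.
  have := @symplectic_basis w 2 e sw be; rewrite wedge_pow2; last by case: cw.
  by rewrite mulf_eq0 negb_or => /andP[].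
apply: (@closed_form_symplectic B 2 [ffun i : 'I_4 => e`_i]) => //.
  exact: size_basis be.
have anti x y : form_of B (pair_args y x) = - form_of B (pair_args x y).
  by rewrite !form_of_pair; case: cB.
by rewrite wedge_pow2 // mulf_neq0 ?pnatr_eq0 // /pf4 !form_of_pair.
Qed.

Lemma admits_symplectic6 (e : 6.-tuple g) : basis_of fullv e ->
  admits_symplectic g <->
  exists B, closed_form B /\ pf6 (fun i j => B e`_i e`_j) != 0.
Proof.
move=> be; split=> [[w sw]|[B [cB pfB]]].
  have cw := symplectic_closed_form sw.
  exists (fun x y : g => w (pair_args x y)); split=> //.
  have := @symplectic_basis w 3 e sw be; rewrite wedge_pow3; last by case: cw.
  by rewrite mulf_eq0 negb_or => /andP[].
apply: (@closed_form_symplectic B 3 [ffun i : 'I_6 => e`_i]) => //.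
  exact: size_basis be.
have anti x y : form_of B (pair_args y x) = - form_of B (pair_args x y).
  by rewrite !form_of_pair; case: cB.
by rewrite wedge_pow3 // mulf_neq0 ?pnatr_eq0 // /pf6 /pf4 !form_of_pair.
Qed.

Lemma lie_bracket0r (x : g) : lie_bracket x 0 = 0.
Proof. by have := lie_linearr (-1) x 0 0; rewrite scaler0 addr0 scaleN1r addNr => ->. Qed.

Lemma lie_bracket0l (x : g) : lie_bracket 0 x = 0.
Proof. by have := lie_linearl (-1) 0 0 x; rewrite scaler0 addr0 scaleN1r addNr => ->. Qed.

Lemma closed_form0l B x : closed_form B -> B 0 x = 0.
Proof.
by case=> lin _ _; have := lin (-1) 0 0 x; rewrite scaler0 addr0 mulN1r addNr => ->.
Qed.

(** Each term of the differential of the added wedge product has [a] or [b] evaluated at a bracket,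
    hence vanishes. *)
Lemma closed_form_wedge (B : g -> g -> F) (a b : g -> F) :
  (forall c x y, a (c *: x + y) = c * a x + a y) ->
  (forall c x y, b (c *: x + y) = c * b x + b y) ->
  (forall x y, a (lie_bracket x y) = 0) ->
  (forall x y, b (lie_bracket x y) = 0) ->
  closed_form B -> closed_form (fun x y => B x y + (a x * b y - a y * b x)).
Proof.
move=> la lb da db [lin anti dB]; split=> [c x y z|x y|x y z].
- by rewrite lin la lb; ring.
- by rewrite anti; ring.
- by rewrite !da !db !mul0r !mulr0 !subr0 !addr0.
Qed.

End LieForms.

(** * Bases and closed forms of a direct sum *)

Lemma dsum_basis (F : fieldType) (g h : lieAlgType F) m n
    (e : m.-tuple g) (f : n.-tuple h) :
  basis_of fullv e -> basis_of fullv f ->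
  basis_of (fullv : {vspace (g * h)%type})
    [tuple of [seq (x, 0) | x <- e] ++ [seq (0, y) | y <- f]].
Proof.
move=> be bf; rewrite basisEdim; apply/andP; split; last first.
  rewrite size_cat !size_map !size_tuple dimvf.
  rewrite -{1}(size_basis be) -{1}(size_basis bf) !dimvf.
  exact: leqnn.
apply/subvP => -[x y] _.
have -> : (x, y) = \sum_i coord e i x *: (e`_i, 0) + \sum_i coord f i y *: (0, f`_i)
    :> g * h.
  rewrite [RHS]surjective_pairing !raddfD /= !raddf_sum /=.
  rewrite -(coord_basis be (memvf x)) -(coord_basis bf (memvf y)).
  by congr (_, _); rewrite big1 ?addr0 ?add0r // => i _; rewrite scaler0.
apply: memvD; apply: memv_suml => i _; apply: memvZ; apply: memv_span;
  rewrite mem_cat; apply/orP; [left|right]; apply/mapP.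
  by exists e`_i; rewrite // mem_nth ?size_tuple.
by exists f`_i; rewrite // mem_nth ?size_tuple.
Qed.

Section ClosedFormsOnSum.
Variables (F : numFieldType) (g h : lieAlgType F).

Lemma closed_form_inl (B : (g * h)%type -> (g * h)%type -> F) :
  closed_form B -> closed_form (fun x y => B (x, 0) (y, 0)).
Proof.
case=> lin anti dB; split=> [c x y z|x y|x y z] //.
  by rewrite -lin; congr (B (_, _) _); rewrite /= scaler0 addr0.
have E x' y' : (lie_bracket x' y', 0) = lie_bracket (x', 0) (y', 0) :> g * h.
  by congr (_, _); rewrite lie_bracket0r.
by rewrite !E dB.
Qed.

(** In the closedness identity at [(x, 0)], [(y, 0)], [(0, z)], two of the three brackets mix the
    summands and vanish. Thus contraction with [(0, z)] is a closed 1-form on [g]. *)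
Lemma closed_form_derived (B : (g * h)%type -> (g * h)%type -> F) x y z :
  closed_form B -> B (lie_bracket x y, 0) (0, z) = 0.
Proof.
move=> cB; case: (cB) => _ _ dB.
have E u : lie_bracket (u, 0) (0, z) = 0 :> g * h.
  by congr (_, _); rewrite /= ?lie_bracket0r ?lie_bracket0l.
have := dB (x, 0) (y, 0) (0, z); rewrite !E !closed_form0l // addr0 subr0.
have -> : lie_bracket (x, 0) (y, 0) = (lie_bracket x y, 0) :> g * h.
  by congr (_, _); rewrite lie_bracket0r.
by move/eqP; rewrite oppr_eq0 => /eqP.
Qed.

(** This is the sum of the pullbacks along the two projections, which are Lie algebra
    homomorphisms. *)
Lemma closed_form_dsum (B : g -> g -> F) (C : h -> h -> F) :
  closed_form B -> closed_form C ->
  closed_form (fun u v : (g * h)%type => B u.1 v.1 + C u.2 v.2).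
Proof.
move=> [linB antiB dB] [linC antiC dC]; split=> [c x y z|x y|x y z] /=.
- by rewrite linB linC; ring.
- by rewrite antiB antiC opprD.
- rewrite -[RHS]addr0 -{1}(dB x.1 y.1 z.1) -(dC x.2 y.2 z.2); ring.
Qed.

End ClosedFormsOnSum.

(** The form is the wedge of the dual basis. Every bracket is the area of its arguments times the
    fixed vector [e], which reduces closedness to an identity between areas. *)
Lemma closed_area_form (F : numFieldType) (h : lieAlgType F) (f : 2.-tuple h) :
  basis_of fullv f ->
  exists C : h -> h -> F, closed_form C /\ C f`_0 f`_1 = 1.
Proof.
move=> bf; pose p := coord f ord0; pose q := coord f (lift ord0 ord0).
exists (fun x y => p x * q y - p y * q x); split; last first.
  have fr := basis_free bf.
  have p0 : p f`_0 = 1 := coord_free ord0 ord0 fr.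
  have p1 : p f`_1 = 0 := coord_free (lift ord0 ord0) ord0 fr.
  have q1 : q f`_1 = 1 := coord_free (lift ord0 ord0) (lift ord0 ord0) fr.
  by rewrite p0 p1 q1 mul1r mul0r subr0.
have expand x : x = p x *: f`_0 + q x *: f`_1.
  rewrite {1}(coord_basis bf (memvf x)) !big_ord_recl big_ord0 addr0 //.
set e := lie_bracket f`_0 f`_1.
have br x y : lie_bracket x y = (p x * q y - p y * q x) *: e.
  have S c u v : lie_bracket (c *: u) v = c *: lie_bracket u v :> h.
    by have := lie_linearl c u 0 v; rewrite addr0 lie_bracket0l addr0.
  have S' c u v : lie_bracket u (c *: v) = c *: lie_bracket u v :> h.
    by have := lie_linearr c u v 0; rewrite addr0 lie_bracket0r addr0.
  rewrite {1}(expand x) {1}(expand y) lie_linearl !lie_linearr !S !S'.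
  rewrite !lie_alternating (lie_anti f`_0) -/e !scaler0 !add0r !addr0.
  by rewrite !scalerN !scalerA scalerBl; congr (_ - _ *: _); rewrite mulrC.
split=> [c x y z|x y|x y z].
- by rewrite /p /q !linearP /=; ring.
- by ring.
(* What remains is the Plücker relation between [x], [y], [z] and [e] in the plane. *)
- by rewrite !br /p /q !linearZ /=; ring.
Qed.

(** * Comparison of the Pfaffians on [r1] and on the sum *)

Theorem mainTheorem3 (R : realType) (r1 r2 : lieAlgType R)
    (dim_r1 : \dim {:r1} = 4%N) (dim_r2 : \dim {:r2} = 2%N) :
  admits_symplectic (r1 * r2)%type <-> admits_symplectic r1.
Proof.
have [e be] : exists e : 4.-tuple r1, basis_of fullv e.
  by rewrite -dim_r1; exists (vbasis fullv); apply: vbasisP.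
have [f bf] : exists f : 2.-tuple r2, basis_of fullv f.
  by rewrite -dim_r2; exists (vbasis fullv); apply: vbasisP.
have bef := dsum_basis be bf.
rewrite (admits_symplectic4 be) (admits_symplectic6 bef).
(* The basis of [r1] comes first, so positions 4 and 5, singled out by [pf6_expand], are those of
   [r2]. *)
set ef := tval _.
have efl i : (i < 4)%N -> ef`_i = (e`_i, 0).
  move=> i4; rewrite /ef /= nth_cat size_map size_tuple i4.
  by rewrite (nth_map 0) // size_tuple.
have efr i : (i < 2)%N -> ef`_(4 + i) = (0, f`_i).
  move=> i2; rewrite /ef /= nth_cat size_map size_tuple ltnNge leq_addr /= addKn.
  by rewrite (nth_map 0) // size_tuple.
have [ef0 ef1 ef2] := And3 (efl 0%N isT) (efl 1%N isT) (efl 2%N isT).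
have [ef3 ef4 ef5] := And3 (efl 3%N isT) (efr 0%N isT) (efr 1%N isT).
split=> [[B [cB pfB]]|[B [cB pfB]]].
  have [lin anti _] := cB.
  have cB1 := closed_form_inl cB.
  (* [a f]_0[and]a f[_1] are the closed 1-forms alpha and beta; [B2] adds their wedge to the
     restriction [B1]. *)
  pose a y x := B (x, 0) (0, y).
  have la y c u v : a y (c *: u + v) = c * a y u + a y v.
    by rewrite /a -lin; congr (B (_, _) _); rewrite /= scaler0 addr0.
  have da y u v : a y (lie_bracket u v) = 0 by exact: closed_form_derived.
  have cB2 := closed_form_wedge (la f`_0) (la f`_1) (da f`_0) (da f`_1) cB1.
  set B1 := (fun x y => _) in cB1; set B2 := (fun x y => _) in cB2.
  have [pf0|] := eqVneq (pf4 (fun i j => B1 e`_i e`_j) 0 1 2 3) 0; last by exists B1.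
  (* If the Pfaffians of [B1] and [B2] both vanished, every term of the expansion of [pf6] would
     vanish. *)
  exists B2; split=> //; apply: contraNneq pfB => pf2; rewrite pf6_expand.
  move: pf0 pf2; rewrite /B2 /B1 /pf4 /a ef0 ef1 ef2 ef3 ef4 ef5 => -> ->.
  by rewrite mulr0 !subr0.
have [C [cC C1]] := closed_area_form bf.
exists (fun u v => B u.1 v.1 + C u.2 v.2); split; first exact: closed_form_dsum.
have C0 x : C 0 x = 0 := closed_form0l x cC.
have B0 x : B 0 x = 0 := closed_form0l x cB.
have B0r x : B x 0 = 0 by case: cB => _ -> _; rewrite B0 oppr0.
(* The entries pairing [r1] with [r2] are zero, so the expansion collapses to the area of [f], which
   is 1, times the Pfaffian of [B]. *)
apply: contraNneq pfB; rewrite pf6_expand /pf4 ef0 ef1 ef2 ef3 ef4 ef5 /=.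
by rewrite C1 !B0 !B0r !C0 => E; apply/eqP; rewrite -[RHS]E; ring.
Qed.
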